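(* Let $\mathbf T=(T_1,\ldots,T_m)$ be a tuple of invertible real $2\times2$ matrices with $\|T_i\|<1$ for $1\le i\le m$, and let $W\in G(2,1)$. Then $$\dim_{\rm AFF}(\mathbf T,W)<\min\{1,\dim_{\rm AFF}(\mathbf T)\}$$ if and only if the following two properties hold: (1) $T_i^*W=W$ for all $1\le i\le m$; (2) letting $a_i$ be the eigenvalue of $T_i^*$ corresponding to $W$, and setting $b_i=\det(T_i)/a_i$ for $1\le i\le m$, one has $t<\min\{1,s\}$, where $s,t$ are the unique positive numbers such that $$\sum_{i=1}^m|a_i|^t=1,\qquad\sum_{i=1}^m|b_i|^s=1.$$
   Context: $\|\cdot\|$ is the operator norm induced by the Euclidean norm on $\mathbb R^2$; $A^*$ is the transpose of $A$. $\Sigma_n=\{1,\ldots,m\}^n$ and $T_I=T_{i_1}\cdots T_{i_n}$ for $I=i_1\cdots i_n$. $G(2,1)$ is the set of one-dimensional linear subspaces of $\mathbb R^2$; $P_W$ is the orthogonal projection onto $W$. The eigenvalue of $T_i^*$ corresponding to $W$ is the $a_i$ with $T_i^*w=a_iw$ for $w\in W$. Singular value function ($d=2$): for a real $2\times 2$ matrix $A$ with singular values $\alpha_1(A)\ge\alpha_2(A)$, $\varphi^s(A)=\alpha_1(A)^s$ for $0\le s<1$, $\varphi^s(A)=\alpha_1(A)\alpha_2(A)^{s-1}$ for $1\le s<2$ (convention $0^0=1$), and $\varphi^s(A)=|\det A|^{s/2}$ for $s\ge2$. $\dim_{\rm AFF}(\mathbf T)=\inf\{s\ge0\colon\lim_{n\to\infty}\frac1n\log\sum_{I\in\Sigma_n}\varphi^s(T_I)\le0\}$,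 and $\dim_{\rm AFF}(\mathbf T,W)=\inf\{s\ge0\colon\sum_{n=1}^\infty\sum_{I\in\Sigma_n}\varphi^s(P_WT_I)<\infty\}$. *)

(* Defs.v *)
From HB Require Import structures.
From mathcomp Require Import all_boot all_order all_algebra.
From mathcomp Require Import all_classical all_reals all_analysis.
From mathcomp Require Import ring lra.

Set Implicit Arguments.
Unset Strict Implicit.
Unset Printing Implicit Defensive.

Import Order.TTheory GRing.Theory Num.Theory.
Import numFieldNormedType.Exports.

Local Open Scope classical_set_scope.
Local Open Scope ring_scope.

(* MathComp-Analysis puts the sup norm on matrices, hence a separate
   Euclidean norm on column vectors. *)
Definition enorm (R : realType) (n : nat) (v : 'cV[R]_n) : R :=
  Num.sqrt (\sum_i v i 0 ^+ 2).

Definition opnorm (R : realType) (n : nat) (A : 'M[R]_n) : R :=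
  sup [set enorm (A *m v) | v in [set v : 'cV[R]_n | enorm v <= 1]].

(* (x, y) is the pair of singular values of A in nonincreasing order: the
   eigenvalues of A^T A, counted with multiplicity, are x ^+ 2 and y ^+ 2. *)
Definition is_singular_values (R : realType) (A : 'M[R]_2) (p : R * R) : Prop :=
  [/\ 0 <= p.2, p.2 <= p.1 &
      char_poly (A^T *m A) = ('X - (p.1 ^+ 2)%:P) * ('X - (p.2 ^+ 2)%:P)].

Definition singular_values (R : realType) (A : 'M[R]_2) : R * R :=
  xget (0, 0) (is_singular_values A).

Lemma det2 (R : comNzRingType) (M : 'M[R]_2) :
  \det M = M 0 0 * M 1 1 - M 0 1 * M 1 0.
Proof.
rewrite (expand_det_row _ 0) !big_ord_recl big_ord0 addr0 /cofactor !det_mx11.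
rewrite !mxE /= !expr0 !expr1 mul1r mulN1r mulrN.
by congr (_ * M _ _ - M _ _ * M _ _); exact: val_inj.
Qed.

Lemma char_poly2 (R : comNzRingType) (M : 'M[R]_2) :
  char_poly M = 'X^2 - (M 0 0 + M 1 1)%:P * 'X + (\det M)%:P.
Proof.
rewrite /char_poly !det2 !mxE /= !mulr1n !mulr0n.
rewrite !polyCD !polyCN !polyCM; ring.
Qed.

Lemma singular_valuesP (R : realType) (A : 'M[R]_2) :
  is_singular_values A (singular_values A).
Proof.
pose M := A^T *m A; pose t := M 0 0 + M 1 1; pose d := \det M.
have [t0 [d0 D0]] : 0 <= t /\ 0 <= d /\ 0 <= t ^+ 2 - 4 * d.
  have -> : t = A 0 0 ^+ 2 + A 1 0 ^+ 2 + A 0 1 ^+ 2 + A 1 1 ^+ 2.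
    rewrite /t !mxE !big_ord_recl !big_ord0 !mxE.
    have -> : lift ord0 ord0 = 1 :> 'I_2 by exact: val_inj.
    ring.
  have -> : d = (A 0 0 * A 1 1 - A 0 1 * A 1 0) ^+ 2.
    by rewrite /d det_mulmx det_tr det2 expr2.
  split; first by rewrite !addr_ge0 ?sqr_ge0.
  split; first exact: sqr_ge0.
  have -> : forall a b c e : R,
    (a ^+ 2 + b ^+ 2 + c ^+ 2 + e ^+ 2) ^+ 2 - 4 * (a * e - c * b) ^+ 2 =
    ((a - e) ^+ 2 + (b + c) ^+ 2) * ((a + e) ^+ 2 + (b - c) ^+ 2).
    by move=> a b c e; ring.
  by rewrite mulr_ge0 ?addr_ge0 ?sqr_ge0.
pose r := Num.sqrt (t ^+ 2 - 4 * d).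
have r0 : 0 <= r by exact: sqrtr_ge0.
have rE : r ^+ 2 = t ^+ 2 - 4 * d by rewrite sqr_sqrtr.
have rt : r <= t by rewrite -(@ler_pXn2r _ 2) // ?nnegrE // rE; lra.
suff H : is_singular_values A
    (Num.sqrt ((t + r) / 2), Num.sqrt ((t - r) / 2)) by exact: (xgetPex _ (ex_intro _ _ H)).
split => /=; first exact: sqrtr_ge0.
  by rewrite ler_wsqrtr //; lra.
rewrite char_poly2 -/M -/t -/d !sqr_sqrtr; [|lra|lra].
have dE : d = (t + r) / 2 * ((t - r) / 2).
  by have -> : d = (t ^+ 2 - r ^+ 2) / 4; [rewrite rE; field | field].
have tE : t = (t + r) / 2 + (t - r) / 2 by field.
rewrite {1}dE {1}tE polyCD polyCM; ring.
Qed.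

Definition svf (R : realType) (s : R) (A : 'M[R]_2) : R :=
  let: (a1, a2) := singular_values A in
  if s < 1 then a1 `^ s
  else if s < 2 then a1 * a2 `^ (s - 1)
  else `|\det A| `^ (s / 2).

(* Orthogonal projection onto the line W, as w w^T / (w^T w) for a spanning
   vector w; only meant for \dim W = 1, see line_projP. *)
Definition line_proj (R : realType) (W : {vspace 'cV[R]_2}) : 'M[R]_2 :=
  let w := vpick W in (((w^T *m w) 0 0)^-1) *: (w *m w^T).

Lemma line_projP (R : realType) (W : {vspace 'cV[R]_2}) (v : 'cV[R]_2) :
  \dim W = 1%N ->
  line_proj W *m v \in W /\
  (forall u, u \in W -> u^T *m (v - line_proj W *m v) = 0).
Proof.
move=> W1; set w := vpick W.
have w0 : w != 0 by rewrite vpick0 -dimv_eq0 W1.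
have WE : W = <[w]>%VS.
  by apply/esym/eqP; rewrite eqEdim -memvE memv_pick W1 dim_vline w0.
have c0 : (w^T *m w) 0 0 != 0.
  apply: contra w0; rewrite mxE; under eq_bigr do rewrite mxE -expr2.
  rewrite psumr_eq0; last by move=> i _; exact: sqr_ge0.
  move=> /allP h; apply/eqP/matrixP => i j; rewrite (ord1 j) mxE.
  by apply/eqP; rewrite -sqrf_eq0; apply: h; rewrite mem_index_enum.
have PE : line_proj W *m v = ((((w^T *m w) 0 0)^-1) * (w^T *m v) 0 0) *: w.
  rewrite /line_proj -/w -scalemxAl -mulmxA [w^T *m v]mx11_scalar mul_mx_scalar.
  by rewrite scalerA [_%:M _ _]mxE eqxx mulr1n.
split; first by rewrite PE memvZ // memv_pick.
move=> u uW; have /vlineP[k ->] : u \in <[w]>%VS by rewrite -WE.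
rewrite linearZ /= -scalemxAl mulmxBr PE -scalemxAr.
suff -> : ((w^T *m w) 0 0)^-1 * (w^T *m v) 0 0 *: (w^T *m w) = w^T *m v.
  by rewrite subrr scaler0.
apply/matrixP => i j; rewrite (ord1 i) (ord1 j) mxE mulrAC mulVf //.
by rewrite mul1r.
Qed.

Definition word_prod (R : realType) (m n : nat) (T : 'I_m -> 'M[R]_2)
  (I : n.-tuple 'I_m) : 'M[R]_2 := \prod_(i <- I) T i.

Definition dim_aff (R : realType) (m : nat) (T : 'I_m -> 'M[R]_2) : \bar R :=
  ereal_inf [set s%:E | s in [set s : R | 0 <= s /\
    exists2 l : R,
      (fun n : nat =>
         n%:R^-1 * ln (\sum_(I : n.-tuple 'I_m) svf s (word_prod T I)))
        @ \oo --> l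
      & l <= 0]].

Definition dim_aff_proj (R : realType) (m : nat) (T : 'I_m -> 'M[R]_2)
  (W : {vspace 'cV[R]_2}) : \bar R :=
  ereal_inf [set s%:E | s in [set s : R | 0 <= s /\
    (\sum_(1 <= n <oo)
       (\sum_(I : n.-tuple 'I_m) svf s (line_proj W *m word_prod T I))%:E
     < +oo)%E]].

(* Main.v *)
Require Import Defs.
From HB Require Import structures.
From mathcomp Require Import all_boot all_order all_algebra.
From mathcomp Require Import all_classical all_reals all_analysis.
From mathcomp Require Import ring lra.

Import Order.TTheory GRing.Theory Num.Theory.
Import numFieldNormedType.Exports.

Local Open Scope classical_set_scope.
Local Open Scope ring_scope.

Set Implicit Arguments.
Unset Strict Implicit.
Unset Printing Implicit Defensive.

(** Write [w] for a spanning vector of [W].  Both sides of the equivalence only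
    involve exponents [x < 1], where the singular value function is a power of
    the largest singular value, hence agrees up to a constant factor with the
    same power of the sup norm (section [svf_small_exponent]).  Up to such
    factors [dim_aff] is governed by the sums [svf_sum] of [`|T_I| `^ x], and
    [dim_aff_proj] by the sums [orbit_sum] of [`|T_I^T w| `^ x]
    ([summable_orbitP]).

    Suppose that the projected series converges at some [x < 1] that lies below
    [dim_aff T].  The sums of [`|T_I| `^ x] are then unbounded in the length of
    [I]: bounded sums would force a nonpositive growth rate ([dim_aff_le]; the
    growth rate exists by Fekete's lemma).  If some [T_i^T w] were not on the
    line [W], then [w] and [T_i^T w] would form a basis, the norm of [T_I] would
    be controlled by [`|T_I^T w|] and [`|T_I^T T_i^T w|], and the second vector
    is the image of [w] under the word [iI], so the sums would be bounded
    ([summable_invariant]).  Hence [W] is invariant, with eigenvalues [a i], and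
    the orthogonal line is invariant under the [T i] with eigenvalues
    [b i = \det (T i) / a i].  The orbit sums are now geometric, so convergence
    says [\sum_i `|a i| `^ x < 1], that is [t < x].  If [s <= t], then
    [\sum_i `|b i| `^ x < 1] as well, and in a basis adapted to [W] the
    transposed products are triangular with both diagonals contracting on
    average, so the sums are bounded again ([svf_sum_bounded]), a contradiction.

    Conversely, up to a constant factor the norm of [T_I] dominates the product
    of the [`|b i|] along [I], so the sums of [`|T_I| `^ x] grow exponentially
    as long as [x < s].  This gives [dim_aff T >= min 1 s], while the projected
    series converges at every exponent between [t] and [1]. *)

(** * Sums over words *)

Lemma sum_words0 (R : realType) (m : nat) (F : seq 'I_m -> R) :
  \sum_(I : 0.-tuple 'I_m) F I = F [::].
Proof.
rewrite (eq_bigr (fun=> F [::])); last by move=> I _; rewrite tuple0.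
by rewrite sumr_const card_tuple expn0.
Qed.

Lemma sum_wordsS (R : realType) (m n : nat) (F : seq 'I_m -> R) :
  \sum_(I : n.+1.-tuple 'I_m) F I =
  \sum_i \sum_(J : n.-tuple 'I_m) F (i :: J).
Proof.
rewrite pair_big /=.
rewrite (reindex
  (fun p : ('I_m * n.-tuple 'I_m)%type => cons_tuple p.1 p.2)) //=.
exists (fun I => (thead I, behead_tuple I)) => [[i J] _ | I _] /=.
  by congr (_, _); exact: val_inj.
by apply: val_inj => /=; rewrite [in RHS](tuple_eta I).
Qed.

Lemma sum_words_cat (R : realType) (m p q : nat) (F : seq 'I_m -> R) :
  \sum_(I : (p + q).-tuple 'I_m) F I =
  \sum_(J : p.-tuple 'I_m) \sum_(K : q.-tuple 'I_m) F (J ++ K).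
Proof.
elim: p F => [|p IH] F.
  by rewrite (sum_words0 (fun J => \sum_(K : q.-tuple 'I_m) F (J ++ K))).
rewrite sum_wordsS
  (sum_wordsS _ (fun J => \sum_(K : q.-tuple 'I_m) F (J ++ K))).
by apply: eq_bigr => i _; rewrite (IH (fun I => F (i :: I))).
Qed.

Lemma sum_words_prod (R : realType) (m n : nat) (f : 'I_m -> R) :
  \sum_(I : n.-tuple 'I_m) \prod_(i <- I) f i = (\sum_i f i) ^+ n.
Proof.
elim: n => [|n IH].
  by rewrite (sum_words0 (fun I => \prod_(i <- I) f i)) big_nil expr0.
rewrite (sum_wordsS _ (fun I => \prod_(i <- I) f i)) exprS mulr_suml.
apply: eq_bigr => i _; rewrite -IH mulr_sumr.
by apply: eq_bigr => J _; rewrite big_cons.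
Qed.

(** * Growth rates of submultiplicative sequences *)

Lemma cvg_invn_mul0 (R : realType) (c : R) :
  (fun n : nat => n%:R^-1 * c) @ \oo --> (0 : R).
Proof.
rewrite -[X in _ --> X](mul0r c); apply: cvgMr_tmp.
by rewrite -(cvg_shiftS (fun n => n%:R^-1 : R)); exact: cvg_harmonic.
Qed.

(** Subadditivity is only assumed up to the constant [c], because passing
    between the singular value and the sup norm costs a constant factor; [u + c]
    is subadditive and has the same growth rate.  The limit is the infimum of
    [(u n + c) / n]: Euclidean division of [n] by a length that nearly attains
    it bounds [u n / n] by a value close to this infimum plus an error of order
    [1 / n]. *)
Lemma fekete (R : realType) (u : nat -> R) (b c : R) :
  (forall p q, u (p + q)%N <= u p + u q + c) ->
  (forall n, n%:R * b <= u n) ->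
  exists l : R, (fun n : nat => n%:R^-1 * u n) @ \oo --> l.
Proof.
move=> uD ub; pose v n := u n + c.
have vD p q : v (p + q)%N <= v p + v q by rewrite /v; have := uD p q; lra.
pose E := [set v n.+1 / n.+1%:R | n in [set: nat]].
have Elb : has_inf E.
  split; first by exists (v 1%N / 1%:R); exists 0%N.
  exists (b - `|c|) => _ [n _ <-].
  rewrite ler_pdivlMr ?ltr0n // mulrBl mulrC /v lerD //.
  have h : `|c| <= `|c| * n.+1%:R by rewrite ler_peMr // ler1n.
  by have := lerNnormlW (lexx `|c|); lra.
pose l := inf E; exists l.
have lv n : (0 < n)%N -> n%:R * l <= v n.
  case: n => // n _; rewrite mulrC -ler_pdivlMr ?ltr0n //.
  by apply: ge_inf; [exact: Elb.2 | exists n].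
apply/cvgrPdist_le => e e0.
have e20 : 0 < e / 2 by lra.
have [_ [k _ <-]] := inf_adherent e20 Elb.
rewrite -/l ltr_pdivrMr ?ltr0n // => vk.
(* The term v 0 makes the bound hold at q = 0, where v 0 need not vanish. *)
have vmul q : v (q * k.+1)%N + v 0%N <= q%:R * v k.+1 + 2 * v 0%N.
  elim: q => [|q IH]; first by rewrite mul0n mul0r; lra.
  by rewrite mulSn -natr1 mulrDl mul1r; have := vD k.+1 (q * k.+1)%N; lra.
pose M := \sum_(r < k.+1) `|v r|.
have vM r : (r < k.+1)%N -> v r <= M.
  move=> rk; apply: le_trans (ler_norm _) _.
  by rewrite /M (bigD1 (Ordinal rk)) //= lerDl sumr_ge0.
pose K := k.+1%:R * `|l + e / 2| + v 0%N + M.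
have vn n : v n <= n%:R * (l + e / 2) + K.
  have h1 := vD (n %/ k.+1 * k.+1)%N (n %% k.+1)%N.
  rewrite -divn_eq in h1.
  have h2 := vM _ (ltn_pmod n (ltn0Sn k)).
  have h3 := vmul (n %/ k.+1)%N.
  have h4 : (n %/ k.+1)%:R * v k.+1 <=
            (n %/ k.+1)%:R * ((l + e / 2) * k.+1%:R).
    by apply: ler_wpM2l; [exact: ler0n | exact: ltW].
  have nE : n%:R = (n %/ k.+1)%:R * k.+1%:R + (n %% k.+1)%:R :> R.
    by rewrite {1}(divn_eq n k.+1) natrD natrM.
  have h5 : - ((n %% k.+1)%:R * (l + e / 2)) <= k.+1%:R * `|l + e / 2|.
    apply: le_trans (_ : (n %% k.+1)%:R * `|l + e / 2| <= _).
      by rewrite -mulrN ler_wpM2l // -normrN ler_norm.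
    by rewrite ler_wpM2r // ler_nat ltnW // ltn_pmod.
  rewrite nE mulrDl /K.
  have -> : (n %/ k.+1)%:R * k.+1%:R * (l + e / 2) =
     (n %/ k.+1)%:R * ((l + e / 2) * k.+1%:R) by ring.
  by move: h1 h2 h3 h4 h5; lra.
near=> n.
have n0 : (0 < n)%N by near: n; exact: nbhs_infty_gt.
have nr0 : 0 < n%:R :> R by rewrite ltr0n.
have nK : (`|c| + `|K|) / (e / 2) <= n%:R by near: n; exact: nbhs_infty_ger.
rewrite ler_pdivrMr // in nK.
have nV : n%:R^-1 * n%:R = 1 :> R by rewrite mulVf // gt_eqF.
have -> : l - n%:R^-1 * u n = n%:R^-1 * (n%:R * l - u n).
  by rewrite mulrBr mulrA nV mul1r.
rewrite normrM gtr0_norm ?invr_gt0 // mulrC ler_pdivrMr //.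
have ne0 : 0 < n%:R * e by rewrite mulr_gt0.
have h1 := vn n; have h2 := lv _ n0; rewrite /v in h1 h2.
have := ler_norm K; have := ler_norm c; have := ler_norm (- c).
rewrite normrN; have := normr_ge0 K; have := normr_ge0 c.
rewrite ler_norml; move: h1 h2 nK; rewrite mulrDr => *.
by apply/andP; split; nra.
Unshelve. all: by end_near. Qed.

Lemma growth_le0 (R : realType) (S : nat -> R) (M l : R) :
  (forall n, 0 < S n <= M) ->
  (fun n : nat => n%:R^-1 * ln (S n)) @ \oo --> l -> l <= 0.
Proof.
move=> SM Sl; apply: (ler_cvg_to Sl (cvg_invn_mul0 (ln M))).
near=> n; rewrite ler_wpM2l ?invr_ge0 //.
have /andP[S0 SMn] := SM n.
by rewrite ler_ln ?posrE //; exact: lt_le_trans SMn.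
Unshelve. all: by end_near. Qed.

Lemma growth_ge (R : realType) (S : nat -> R) (k q l : R) :
  0 < k -> 0 < q -> (forall n, k * q ^+ n <= S n) ->
  (fun n : nat => n%:R^-1 * ln (S n)) @ \oo --> l -> ln q <= l.
Proof.
move=> k0 q0 kS Sl.
have cl : (fun n : nat => n%:R^-1 * ln k + ln q) @ \oo --> 0 + ln q.
  by apply: cvgD; [exact: cvg_invn_mul0 | exact: cvg_cst].
rewrite add0r in cl; apply: (ler_cvg_to cl Sl).
near=> n.
have n0 : (0 < n)%N by near: n; exact: nbhs_infty_gt.
have kq : 0 < k * q ^+ n by rewrite mulr_gt0 // exprn_gt0.
apply: le_trans (_ : n%:R^-1 * ln (k * q ^+ n) <= _); last first.
  rewrite ler_wpM2l ?invr_ge0 // ler_ln ?posrE //.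
  exact: lt_le_trans (kS n).
rewrite lnM ?posrE ?exprn_gt0 // lnXn // mulrDr lerD2l.
by rewrite -[ln q *+ n]mulr_natl mulrA mulVf ?mul1r // pnatr_eq0 -lt0n.
Unshelve. all: by end_near. Qed.

(** * The sup norm and the singular values of a matrix *)

Lemma le_mx_norm (R : realType) (p q : nat) (A : 'M[R]_(p, q)) i j :
  `|A i j| <= `|A|.
Proof.
rewrite [leRHS]/Num.norm /= mx_normrE.
exact: (le_bigmax _ (fun ij : ('I_p * 'I_q)%type => `|A ij.1 ij.2|) (i, j)).
Qed.

Lemma mx_norm_le (R : realType) (p q : nat) (A : 'M[R]_(p, q)) (c : R) :
  0 <= c -> (forall i j, `|A i j| <= c) -> `|A| <= c.
Proof.
move=> c0 Ac; rewrite [leLHS]/Num.norm /= mx_normrE.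
by apply/bigmax_leP; split => // -[i j] _; exact: Ac.
Qed.

Lemma mx_norm_mul (R : realType) (p q r : nat) (A : 'M[R]_(p, q))
    (B : 'M[R]_(q, r)) : `|A *m B| <= q%:R * (`|A| * `|B|).
Proof.
apply: mx_norm_le => [|i j]; first by rewrite !mulr_ge0.
rewrite mxE (le_trans (ler_norm_sum _ _ _)) //.
rewrite mulr_natl -[X in _ *+ X](card_ord q) -sumr_const.
by apply: ler_sum => k _; rewrite normrM ler_pM // le_mx_norm.
Qed.

Lemma mx_norm_tr (R : realType) (p q : nat) (A : 'M[R]_(p, q)) :
  `|A^T| = `|A|.
Proof.
apply/eqP; rewrite eq_le; apply/andP; split; apply: mx_norm_le => // i j.
  by rewrite mxE le_mx_norm.
by have := le_mx_norm A^T j i; rewrite mxE.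
Qed.

Lemma sum_ord2 (V : nmodType) (F : 'I_2 -> V) : \sum_i F i = F 0 + F 1.
Proof.
by rewrite !big_ord_recl big_ord0 addr0; congr (_ + F _); exact: val_inj.
Qed.

Lemma ord2P (P : 'I_2 -> Prop) : P 0 -> P 1 -> forall i, P i.
Proof.
move=> P0 P1 [[|[|//]] i2]; [have -> : Ordinal i2 = 0 by exact: val_inj|] => //.
by have -> : Ordinal i2 = 1 by exact: val_inj.
Qed.

Lemma dot_gt0 (R : realType) (w : 'cV[R]_2) : w != 0 ->
  0 < w 0 0 ^+ 2 + w 1 0 ^+ 2.
Proof.
move=> w0; rewrite lt_neqAle addr_ge0 ?sqr_ge0 // andbT eq_sym.
apply: contra w0; rewrite paddr_eq0 ?sqr_ge0 // !sqrf_eq0.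
case/andP=> /eqP h0 /eqP h1; apply/eqP/matrixP => i j; rewrite (ord1 j) mxE.
by move: i; apply: ord2P.
Qed.

(** The trace and the determinant of [A^T *m A], read off from the values of its
    characteristic polynomial at 0 and 1. *)
Lemma singular_values_sum (R : realType) (A : 'M[R]_2) :
  (singular_values A).1 ^+ 2 + (singular_values A).2 ^+ 2 =
  \sum_i \sum_j A i j ^+ 2 /\
  (singular_values A).1 ^+ 2 * (singular_values A).2 ^+ 2 = \det A ^+ 2.
Proof.
have [_ _] := singular_valuesP A; set a := _.1; set b := _.2 => E.
have E0 := congr1 (fun p => p.[0]) E; have E1 := congr1 (fun p => p.[1]) E.
rewrite char_poly2 !hornerE /= in E0 E1.
rewrite det_mulmx det_tr !mxE !sum_ord2 !mxE in E0 E1.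
by rewrite !sum_ord2; split; lra.
Qed.

Section singular_value.
Variables (R : realType).
Implicit Types A B : 'M[R]_2.

Lemma singular_value_ge0 A : 0 <= (singular_values A).1.
Proof. by have [b0 ba _] := singular_valuesP A; exact: le_trans ba. Qed.

Lemma singular_value_le A : (singular_values A).1 <= 2 * `|A|.
Proof.
rewrite -(@ler_pXn2r _ 2) ?nnegrE ?mulr_ge0 ?singular_value_ge0 //.
have [E _] := singular_values_sum A.
have h i j : A i j ^+ 2 <= `|A| ^+ 2.
  by rewrite -[leLHS]real_normK ?num_real // lerXn2r ?nnegrE ?le_mx_norm.
have := sqr_ge0 (singular_values A).2.
move: E; rewrite !sum_ord2 exprMn.
have := h 0 0; have := h 0 1; have := h 1 0; have := h 1 1; lra.
Qed.

Lemma mx_norm_le_singular_value A : `|A| <= 2 * (singular_values A).1.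
Proof.
have a0 := singular_value_ge0 A.
apply: mx_norm_le => [|i j]; first by rewrite mulr_ge0.
rewrite -(@ler_pXn2r _ 2) ?nnegrE ?mulr_ge0 // real_normK ?num_real //.
have [E _] := singular_values_sum A.
have [b0 ba _] := singular_valuesP A.
have ba2 : (singular_values A).2 ^+ 2 <= (singular_values A).1 ^+ 2.
  by rewrite lerXn2r ?nnegrE.
apply: (@le_trans _ _ (\sum_i \sum_j A i j ^+ 2)).
  rewrite (bigD1 i) //= (bigD1 j) //= -addrA lerDl addr_ge0 //.
    by apply: sumr_ge0 => *; exact: sqr_ge0.
  by apply: sumr_ge0 => *; apply: sumr_ge0 => *; exact: sqr_ge0.
by rewrite -E exprMn; have := sqr_ge0 (singular_values A).1; lra.
Qed.

Lemma det_le_singular_value A : `|\det A| <= (singular_values A).1 ^+ 2.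
Proof.
have [b0 ba _] := singular_valuesP A.
rewrite -(@ler_pXn2r _ 2) ?nnegrE ?sqr_ge0 // real_normK ?num_real //.
rewrite -(singular_values_sum A).2 expr2 ler_wpM2l ?sqr_ge0 //.
by rewrite lerXn2r ?nnegrE // singular_value_ge0.
Qed.

End singular_value.

Lemma powR_prod (R : realType) (I : Type) (s : seq I) (f : I -> R) (x : R) :
  (forall i, 0 <= f i) ->
  (\prod_(i <- s) f i) `^ x = \prod_(i <- s) f i `^ x.
Proof.
move=> f0; elim: s => [|i s IH]; first by rewrite !big_nil powR1.
by rewrite !big_cons powRM ?IH // prodr_ge0.
Qed.

(** For [c <= a + b] the fraction [c / (a + b)] is at most its own [x]-th power,
    and the fractions of [a] and [b] sum to 1. *)
Lemma powRD_le (R : realType) (a b x : R) :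
  0 <= a -> 0 <= b -> 0 <= x -> x <= 1 -> (a + b) `^ x <= a `^ x + b `^ x.
Proof.
rewrite le_eqVlt => /predU1P[<- b0 *|a0].
  by rewrite add0r lerDr powR_ge0.
rewrite le_eqVlt => /predU1P[<- *|b0 x0 x1].
  by rewrite addr0 lerDl powR_ge0.
have ab0 : 0 < a + b by lra.
have frac c : 0 < c -> c <= a + b ->
    c / (a + b) * (a + b) `^ x <= c `^ x.
  move=> c0 cab; rewrite -[X in _ <= X `^ _](divfK (lt0r_neq0 ab0)).
  have cd0 : 0 < c / (a + b) by rewrite divr_gt0.
  rewrite (powRM _ (ltW cd0) (ltW ab0)) ler_wpM2r ?powR_ge0 // ger1_powR //.
  by rewrite cd0 ler_pdivrMr // mul1r.
have -> : (a + b) `^ x =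
    a / (a + b) * (a + b) `^ x + b / (a + b) * (a + b) `^ x.
  by field; lra.
by apply: lerD; apply: frac => //; lra.
Qed.

Lemma powR_le2 (R : realType) (x : R) : x <= 1 -> 2 `^ x <= 2 :> R.
Proof. by move=> x1; apply: ler1_powR => //; lra. Qed.

Section svf_small_exponent.
Variables (R : realType) (x : R).
Hypotheses (x0 : 0 <= x) (x1 : x < 1).
Implicit Types A B : 'M[R]_2.

Lemma svf_lt1 A : svf x A = (singular_values A).1 `^ x.
Proof. by rewrite /svf; case: singular_values => a b; rewrite x1. Qed.

Lemma svf_le A : svf x A <= 2 * `|A| `^ x.
Proof.
rewrite svf_lt1.
apply: (@le_trans _ _ ((2 * `|A|) `^ x)).
  by rewrite ge0_ler_powR ?nnegrE ?mulr_ge0 ?singular_value_ge0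
    ?singular_value_le.
by rewrite powRM // ler_wpM2r ?powR_ge0 // powR_le2 // ltW.
Qed.

Lemma le_svf A : `|A| `^ x <= 2 * svf x A.
Proof.
rewrite svf_lt1; have a0 := singular_value_ge0 A.
apply: (@le_trans _ _ ((2 * (singular_values A).1) `^ x)).
  by rewrite ge0_ler_powR ?nnegrE ?mulr_ge0 ?mx_norm_le_singular_value.
by rewrite powRM // ler_wpM2r ?powR_ge0 // powR_le2 // ltW.
Qed.

(** The sup norm is submultiplicative up to a factor 2; the remaining factor 8
    pays for the three passages between it and the singular value. *)
Lemma svf_mul A B : svf x (A *m B) <= 16 * (svf x A * svf x B).
Proof.
apply: le_trans (svf_le _) _.
apply: (@le_trans _ _ (2 * (2 * (`|A| * `|B|)) `^ x)).
  by rewrite ler_pM2l ?ltr0n // ge0_ler_powR ?nnegrE ?mulr_ge0 ?mx_norm_mul.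
rewrite !powRM ?mulr_ge0 //.
have h : 0 <= `|A| `^ x * `|B| `^ x by rewrite mulr_ge0 ?powR_ge0.
have h1 : 2 `^ x * (`|A| `^ x * `|B| `^ x) <= 2 * (`|A| `^ x * `|B| `^ x).
  by rewrite ler_wpM2r // powR_le2 // ltW.
have h2 : `|A| `^ x * `|B| `^ x <= 2 * svf x A * (2 * svf x B).
  by rewrite ler_pM ?powR_ge0 // le_svf.
by move: h1 h2; lra.
Qed.

Lemma det_le_svf A : `|\det A| `^ (x / 2) <= svf x A.
Proof.
rewrite svf_lt1; have a0 := singular_value_ge0 A.
apply: (@le_trans _ _ (((singular_values A).1 ^+ 2) `^ (x / 2))).
  rewrite ge0_ler_powR ?nnegrE ?sqr_ge0 ?det_le_singular_value //.
  by rewrite divr_ge0.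
by rewrite -powR_mulrn // -powRrM mulrC divfK.
Qed.

End svf_small_exponent.

(** * Growth of the singular value sums and the affinity dimension *)

Section word_sums.
Variables (R : realType) (m : nat) (T : 'I_m -> 'M[R]_2).
Implicit Types (x : R) (u v w : 'cV[R]_2).

Definition svf_sum x n := \sum_(I : n.-tuple 'I_m) svf x (word_prod T I).

Definition orbit_sum x u n :=
  \sum_(I : n.-tuple 'I_m) `|(word_prod T I)^T *m u| `^ x.

Lemma orbit_sum_ge0 x u n : 0 <= orbit_sum x u n.
Proof. by apply: sumr_ge0 => I _; exact: powR_ge0. Qed.

(** The transposes act in reverse order, so prefixing a letter to a word changes
    the vector on which the rest of the word acts. *)
Lemma orbit_sumS x u n :
  orbit_sum x u n.+1 = \sum_i orbit_sum x ((T i)^T *m u) n.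
Proof.
rewrite /orbit_sum /word_prod.
rewrite (sum_wordsS _ (fun s => `|(\prod_(i <- s) T i)^T *m u| `^ x)).
apply: eq_bigr => i _; apply: eq_bigr => J _.
by rewrite big_cons -mulmxE trmx_mul mulmxA.
Qed.

Section small_exponent.
Variable x : R.
Hypotheses (m0 : (0 < m)%N) (Tinv : forall i, T i \in unitmx).
Hypotheses (x0 : 0 <= x) (x1 : x < 1).

Lemma svf_sum_submul p q :
  svf_sum x (p + q) <= 16 * (svf_sum x p * svf_sum x q).
Proof.
rewrite /svf_sum /word_prod.
rewrite (sum_words_cat _ _ (fun s => svf x (\prod_(i <- s) T i))).
rewrite mulr_suml mulr_sumr; apply: ler_sum => J _.
rewrite !mulr_sumr; apply: ler_sum => K _.
by rewrite big_cat /= -mulmxE svf_mul.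
Qed.

Lemma det_sum_gt0 : 0 < \sum_i `|\det (T i)| `^ (x / 2).
Proof.
rewrite (bigD1 (Ordinal m0)) //= ltr_pwDl //; last first.
  by apply: sumr_ge0 => *; exact: powR_ge0.
by rewrite powR_gt0 // normr_gt0 -unitfE -unitmxE.
Qed.

(** A lower bound for the sums that is multiplicative in the word, as the
    determinant is; it keeps the growth rate away from minus infinity. *)
Lemma det_sum_le n : (\sum_i `|\det (T i)| `^ (x / 2)) ^+ n <= svf_sum x n.
Proof.
rewrite -sum_words_prod; apply: ler_sum => I _.
rewrite -powR_prod //; apply: le_trans (det_le_svf x0 x1 _).
rewrite /word_prod (big_morph _ (@det_mulmx R 2) (det1 R 2)).
by rewrite normr_prod.
Qed.

Lemma svf_sum_gt0 n : 0 < svf_sum x n.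
Proof.
by apply: lt_le_trans (det_sum_le n); rewrite exprn_gt0 ?det_sum_gt0.
Qed.

Lemma pressure_exists :
  exists l : R, (fun n : nat => n%:R^-1 * ln (svf_sum x n)) @ \oo --> l.
Proof.
apply: (@fekete _ _ (ln (\sum_i `|\det (T i)| `^ (x / 2))) (ln 16)).
  move=> p q.
  rewrite -lnM ?posrE ?svf_sum_gt0 // -lnM ?posrE ?mulr_gt0 ?svf_sum_gt0 //.
  rewrite ler_ln ?posrE ?mulr_gt0 ?svf_sum_gt0 //.
  by rewrite [leRHS]mulrC svf_sum_submul.
move=> n; rewrite mulr_natl -lnXn ?det_sum_gt0 //.
by rewrite ler_ln ?posrE ?exprn_gt0 ?det_sum_gt0 ?svf_sum_gt0 ?det_sum_le.
Qed.

(** Fekete's lemma provides the limit whose existence is part of the definition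
    of [dim_aff]. *)
Lemma dim_aff_le M : (forall n, svf_sum x n <= M) -> (dim_aff T <= x%:E)%E.
Proof.
move=> SM; have [l Sl] := pressure_exists.
apply: ereal_inf_lbound; exists x => //; split => //; exists l => //.
apply: (@growth_le0 _ _ M _ _ Sl) => n.
by rewrite svf_sum_gt0 SM.
Qed.

End small_exponent.

Lemma dim_aff_ge y : y <= 1 ->
  (forall x, 0 <= x -> x < y ->
    exists k q, [/\ 0 < k, 1 < q & forall n, k * q ^+ n <= svf_sum x n]) ->
  (y%:E <= dim_aff T)%E.
Proof.
move=> y1 grow; apply/ereal_infP => _ [x [x0 [l Sl l0]] <-].
rewrite lee_fin leNgt; apply/negP => xy.
have [k [q [k0 q1 kS]]] := grow x x0 xy.
have q0 : 0 < q by lra.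
have := growth_ge k0 q0 kS Sl.
by rewrite leNgt (le_lt_trans l0) // ln_gt0.
Qed.

(** Cramer's rule recovers the entries of [A] from the images of the two basis
    vectors. *)
Lemma mx_norm_le_basis u v : u 0 0 * v 1 0 - u 1 0 * v 0 0 != 0 ->
  exists2 C, 0 <= C & forall A : 'M[R]_2, `|A| <= C * (`|A *m u| + `|A *m v|).
Proof.
set d := _ - _ => d0; exists (`|d|^-1 * (`|u| + `|v|)).
  by rewrite mulr_ge0 ?addr_ge0 ?invr_ge0.
move=> A.
have bound a b c e : `|a| <= `|A *m u| -> `|b| <= `|v| ->
    `|c| <= `|A *m v| -> `|e| <= `|u| ->
    `|d^-1 * (a * b - c * e)| <=
    `|d|^-1 * (`|u| + `|v|) * (`|A *m u| + `|A *m v|).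
  move=> ha hb hc he; rewrite normrM normfV -mulrA ler_wpM2l ?invr_ge0 //.
  apply: le_trans (ler_normB _ _) _; rewrite !normrM.
  have h1 : `|a| * `|b| <= `|A *m u| * `|v| by rewrite ler_pM.
  have h2 : `|c| * `|e| <= `|A *m v| * `|u| by rewrite ler_pM.
  have h3 : 0 <= `|A *m u| * `|u| by rewrite mulr_ge0.
  have h4 : 0 <= `|A *m v| * `|v| by rewrite mulr_ge0.
  by move: h1 h2 h3 h4; lra.
have vE i (z : 'cV[R]_2) : (A *m z) i 0 = A i 0 * z 0 0 + A i 1 * z 1 0.
  by rewrite mxE sum_ord2.
apply: mx_norm_le => [|i j].
  by rewrite !mulr_ge0 ?addr_ge0 ?invr_ge0.
move: j; apply: ord2P.
  have -> : A i 0 = d^-1 * ((A *m u) i 0 * v 1 0 - (A *m v) i 0 * u 1 0).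
    by rewrite !vE /d; field.
  by apply: bound; exact: le_mx_norm.
have -> : A i 1 = d^-1 * ((A *m u) i 0 * - v 0 0 - (A *m v) i 0 * - u 0 0).
  by rewrite !vE /d; field.
by apply: bound; rewrite ?normrN; exact: le_mx_norm.
Qed.

Lemma svf_sum_le_orbits x u v : 0 <= x -> x < 1 ->
  u 0 0 * v 1 0 - u 1 0 * v 0 0 != 0 ->
  exists2 C, 0 <= C &
    forall n, svf_sum x n <= C * (orbit_sum x u n + orbit_sum x v n).
Proof.
move=> x0 x1 /mx_norm_le_basis[C C0 hC]; exists (2 * C `^ x) => [|n].
  by rewrite mulr_ge0 ?powR_ge0.
rewrite /orbit_sum -big_split mulr_sumr; apply: ler_sum => I _ /=.
apply: le_trans (svf_le x0 x1 _) _; rewrite -mulrA ler_wpM2l //.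
set A := word_prod T I.
apply: (@le_trans _ _ ((C * (`|A^T *m u| + `|A^T *m v|)) `^ x)).
  rewrite ge0_ler_powR ?nnegrE ?mulr_ge0 ?addr_ge0 //.
  by rewrite -[leLHS]mx_norm_tr.
rewrite powRM ?addr_ge0 // ler_wpM2l ?powR_ge0 // powRD_le //.
exact: ltW.
Qed.

End word_sums.

(** * Convergence of the projected series *)

Lemma nneseries_fin_bounded (R : realType) (c : nat -> R) :
  (forall n, 0 <= c n) ->
  (\sum_(1 <= n <oo) (c n)%:E < +oo)%E <->
  exists M, forall N, \sum_(1 <= n < N) c n <= M.
Proof.
move=> c0; have c0E n : true -> (0 <= (c n)%:E)%E by rewrite lee_fin.
split=> [fin | [M cM]]; last first.
  apply: (@le_lt_trans _ _ M%:E); last exact: ltry.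
  apply: lime_le; first by apply: is_cvg_nneseries => n _ _; exact: c0E.
  by near=> N; rewrite sumEFin lee_fin.
set s := limn _ in fin.
have le_s N : (\sum_(1 <= n < N) (c n)%:E <= s)%E.
  by apply: nneseries_lim_ge => n _; exact: c0E.
have s0 : (0 <= s)%E by apply: le_trans (le_s 0%N); rewrite big_geq.
exists (fine s) => N; rewrite -lee_fin -sumEFin fineK ?le_s //.
by rewrite ge0_fin_numE.
Unshelve. all: by end_near. Qed.

Section projection.
Variables (R : realType) (m : nat) (T : 'I_m -> 'M[R]_2).
Variables (W : {vspace 'cV[R]_2}) (hW : \dim W = 1%N).
Let w := vpick W.

Lemma vpick_line_neq0 : w != 0.
Proof. by rewrite vpick0 -dimv_eq0 hW. Qed.

Lemma line_vpick : W = <[w]>%VS.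
Proof.
apply/esym/eqP; rewrite eqEdim -memvE memv_pick hW dim_vline.
by rewrite vpick_line_neq0.
Qed.

(** With [P] the projection, [P A] is a multiple of [w *m (A^T w)^T], which
    gives the upper bound; the lower one holds because [w^T P A = (A^T w)^T]. *)
Lemma svf_proj x : 0 <= x -> x < 1 -> exists k K, [/\ 0 < k, 0 < K &
  forall A : 'M[R]_2, k * `|A^T *m w| `^ x <= svf x (line_proj W *m A) /\
                      svf x (line_proj W *m A) <= K * `|A^T *m w| `^ x].
Proof.
move=> x0 x1; have d0 := dot_gt0 vpick_line_neq0.
have dE : (w^T *m w) 0 0 = w 0 0 ^+ 2 + w 1 0 ^+ 2.
  by rewrite mxE sum_ord2 !mxE.
pose P := line_proj W.
have w0 : 0 < `|w| by rewrite normr_gt0 vpick_line_neq0.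
have PE (A : 'M[R]_2) :
    P *m A = ((w^T *m w) 0 0)^-1 *: (w *m (A^T *m w)^T).
  by rewrite /P /line_proj -/w -scalemxAl trmx_mul trmxK mulmxA.
have wP : w^T *m P = w^T.
  rewrite /P /line_proj -/w -scalemxAr mulmxA [w^T *m w]mx11_scalar.
  rewrite mul_scalar_mx scalerA [_%:M _ _]mxE mulr1n.
  by rewrite mulVf ?scale1r // dE gt_eqF.
pose K := `|((w^T *m w) 0 0)^-1| * `|w|.
have K0 : 0 < K by rewrite mulr_gt0 // normr_gt0 invr_neq0 // dE gt_eqF.
have lower (A : 'M[R]_2) : `|A^T *m w| <= 2 * `|w| * `|P *m A|.
  rewrite -mx_norm_tr trmx_mul trmxK -{1}wP -mulmxA.
  by apply: le_trans (mx_norm_mul _ _) _; rewrite mulrA mx_norm_tr.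
have upper (A : 'M[R]_2) : `|P *m A| <= K * `|A^T *m w|.
  rewrite PE mx_normZ /K -mulrA ler_wpM2l //.
  by apply: le_trans (mx_norm_mul _ _) _; rewrite mul1r mx_norm_tr.
exists ((2 * (2 * `|w|) `^ x)^-1), (2 * K `^ x); split.
- by rewrite invr_gt0 mulr_gt0 ?powR_gt0 ?mulr_gt0.
- by rewrite mulr_gt0 ?powR_gt0.
move=> A; split.
  rewrite mulrC ler_pdivrMr ?mulr_gt0 ?powR_gt0 ?mulr_gt0 //.
  apply: (@le_trans _ _ ((2 * `|w| * `|P *m A|) `^ x)).
    by rewrite ge0_ler_powR ?nnegrE ?mulr_ge0.
  rewrite powRM ?mulr_ge0 //.
  apply: le_trans (ler_wpM2l (powR_ge0 _ _) (le_svf x0 x1 _)) _.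
  by rewrite mulrCA [leRHS]mulrC -mulrA.
apply: le_trans (svf_le x0 x1 _) _; rewrite -mulrA ler_wpM2l //.
rewrite -powRM ?(ltW K0) //.
by rewrite ge0_ler_powR ?nnegrE ?mulr_ge0 ?(ltW K0).
Qed.

(** The empty word is left out, as in the series that defines [dim_aff_proj]. *)
Definition summable_orbit x :=
  exists M, forall N, \sum_(1 <= n < N) orbit_sum T x w n <= M.

Lemma summable_orbitP x : 0 <= x -> x < 1 ->
  (\sum_(1 <= n <oo)
     (\sum_(I : n.-tuple 'I_m) svf x (line_proj W *m word_prod T I))%:E
   < +oo)%E <-> summable_orbit x.
Proof.
move=> x0 x1; have [k [K [k0 K0 kK]]] := svf_proj x0 x1.
set c := fun n => \sum_(I : n.-tuple 'I_m) svf x (line_proj W *m word_prod T I).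
have c0 n : 0 <= c n.
  by apply: sumr_ge0 => I _; rewrite svf_lt1 // powR_ge0.
rewrite (nneseries_fin_bounded c0); split=> -[M hM].
  exists (k^-1 * M) => N; rewrite mulrC ler_pdivlMr // mulrC.
  apply: le_trans (hM N); rewrite mulr_sumr; apply: ler_sum => n _.
  by rewrite mulr_sumr; apply: ler_sum => I _; have [] := kK (word_prod T I).
exists (K * M) => N.
apply: (@le_trans _ _ (K * \sum_(1 <= n < N) orbit_sum T x w n)).
  rewrite mulr_sumr; apply: ler_sum => n _.
  by rewrite mulr_sumr; apply: ler_sum => I _; have [] := kK (word_prod T I).
by rewrite ler_pM2l.
Qed.

End projection.

(** * Power sums of numbers in the unit interval *)

Section power_sums.
Variables (R : realType) (m : nat) (c : 'I_m -> R).
Hypothesis c01 : forall i, 0 < c i < 1.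

Definition power_sum (x : R) := \sum_i c i `^ x.

Lemma power_sum_ge0 x : 0 <= power_sum x.
Proof. by apply: sumr_ge0 => i _; exact: powR_ge0. Qed.

Lemma power_sum_decr x y : (0 < m)%N -> x < y -> power_sum y < power_sum x.
Proof.
move=> m0 xy; apply: ltr_sum => [|i _].
  by apply/hasP; exists (Ordinal m0) => //; rewrite mem_index_enum.
have /andP[ci0 ci1] := c01 i.
by rewrite /powR gt_eqF // ltr_expR ltr_nM2r // ln_lt0 // c01.
Qed.

Lemma power_sum_continuous : continuous power_sum.
Proof.
apply: (@continuous_big R _ +%R 0 _ (@add_continuous R)) => i _ x.
have /andP[ci0 _] := c01 i.
rewrite /powR gt_eqF //; apply: continuous_comp; last exact: continuous_expR.
by apply: cvgMr_tmp; exact: cvg_id.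
Qed.

Lemma power_sum_lt1 : (0 < m)%N -> exists2 y, 0 < y & power_sum y < 1.
Proof.
move=> m0; have L0 i : 0 < - ln (c i) by rewrite oppr_gt0 ln_lt0 // c01.
(* At this y each term is at most 1 / (1 + m), by expR z >= 1 + z. *)
pose y := \sum_i m%:R / - ln (c i).
have yi i : m%:R / - ln (c i) <= y.
  rewrite /y (bigD1 i) //= lerDl; apply: sumr_ge0 => j _.
  by rewrite divr_ge0 // ltW.
exists y.
  by apply: lt_le_trans (yi (Ordinal m0)); rewrite divr_gt0 ?ltr0n.
have small i : c i `^ y < m%:R^-1.
  have /andP[ci0 _] := c01 i.
  rewrite /powR gt_eqF // -[y * _]opprK expRN.
  rewrite ltf_pV2 ?posrE ?expR_gt0 ?ltr0n //.
  apply: lt_le_trans (expR_ge1Dx _); rewrite -mulrN.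
  by have := yi i; rewrite ler_pdivrMr //; lra.
apply: (@lt_le_trans _ _ (\sum_(i < m) m%:R^-1)).
  apply: ltr_sum => //.
  by apply/hasP; exists (Ordinal m0) => //; rewrite mem_index_enum.
by rewrite sumr_const card_ord -[_ *+ m]mulr_natl divff // pnatr_eq0 -lt0n.
Qed.

Lemma power_sum_root : (1 < m)%N ->
  exists t, unique (fun x => 0 < x /\ power_sum x = 1) t.
Proof.
move=> m1; have m0 : (0 < m)%N by exact: ltn_trans m1.
have [y y0 y1] := power_sum_lt1 m0.
have p0 : power_sum 0 = m%:R.
  rewrite /power_sum; under eq_bigr do rewrite powRr0.
  by rewrite sumr_const card_ord.
have m1R : 1 < power_sum 0 by rewrite p0 ltr1n.
have [||t] := @IVT R power_sum 0 y 1 (ltW y0).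
- by apply: continuous_subspaceT; exact: power_sum_continuous.
- by rewrite min_r ?max_l ?ltW //; exact: lt_trans m1R.
rewrite in_itv /= => /andP[t0 _] pt; exists t; split.
  split=> //; rewrite lt_neqAle t0 andbT; apply/eqP => t00.
  by move: m1R; rewrite t00 pt ltxx.
move=> z [_ pz]; apply/eqP; rewrite eq_le !leNgt.
by apply/andP; split; apply/negP => /(power_sum_decr m0); rewrite pt pz ltxx.
Qed.

End power_sums.

(** * Eigenvalues of planar contractions *)

Section contraction_eigenvalues.
Variable R : realType.
Implicit Types (A : 'M[R]_2) (u v w : 'cV[R]_2).

Lemma enorm2 v : enorm v = Num.sqrt (v 0 0 ^+ 2 + v 1 0 ^+ 2).
Proof. by rewrite /enorm sum_ord2. Qed.

Lemma enormZ (c : R) v : enorm (c *: v) = `|c| * enorm v.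
Proof.
by rewrite !enorm2 !mxE !exprMn -mulrDr sqrtrM ?sqr_ge0 // sqrtr_sqr.
Qed.

Lemma enorm_gt0 v : v != 0 -> 0 < enorm v.
Proof.
by move=> v0; rewrite enorm2 sqrtr_gt0 dot_gt0.
Qed.

Lemma mx_norm_le_enorm v : `|v| <= enorm v.
Proof.
rewrite enorm2; apply: mx_norm_le => [|i j]; first exact: sqrtr_ge0.
rewrite (ord1 j) -sqrtr_sqr ler_wsqrtr //.
by move: i; apply: ord2P; rewrite ?lerDl ?lerDr sqr_ge0.
Qed.

Lemma enorm_le v : enorm v <= 2 * `|v|.
Proof.
rewrite enorm2 -[leRHS]ger0_norm ?mulr_ge0 // -sqrtr_sqr ler_wsqrtr // exprMn.
have h i : v i 0 ^+ 2 <= `|v| ^+ 2.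
  by rewrite -[leLHS]real_normK ?num_real // lerXn2r ?nnegrE ?le_mx_norm.
by have := h 0; have := h 1; have := sqr_ge0 `|v|; lra.
Qed.

Lemma eigenvalue_le_opnorm A v (c : R) :
  v != 0 -> A *m v = c *: v -> `|c| <= opnorm A.
Proof.
move=> v0 Av; have e0 := enorm_gt0 v0.
have eV : `|(enorm v)^-1| = (enorm v)^-1 by rewrite gtr0_norm // invr_gt0.
apply: ub_le_sup.
  exists (2 * (2 * `|A|)) => _ [u u1 <-].
  apply: le_trans (enorm_le _) _; rewrite ler_pM2l //.
  apply: le_trans (mx_norm_mul _ _) _; rewrite ler_pM2l // ler_piMr //.
  exact: le_trans (mx_norm_le_enorm u) u1.
exists ((enorm v)^-1 *: v) => /=.
  by rewrite enormZ eV mulVf // gt_eqF.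
rewrite -scalemxAr Av !enormZ eV.
by rewrite mulrCA mulVf ?mulr1 // gt_eqF.
Qed.

(** A matrix and its transpose have the same eigenvalues, so the eigenvector of
    [A^T] can be traded for one of [A]. *)
Lemma tr_eigenvalue_le_opnorm A w (c : R) :
  w != 0 -> A^T *m w = c *: w -> `|c| <= opnorm A.
Proof.
move=> w0 Aw.
have : \det (A - c%:M)^T == 0.
  rewrite det_tr; apply/det0P; exists w^T; first by rewrite trmx_eq0.
  by rewrite mulmxBr -[A]trmxK -trmx_mul Aw linearZ /= mul_mx_scalar subrr.
case/det0P=> u u0 uA; apply: (@eigenvalue_le_opnorm A u^T).
  by rewrite trmx_eq0.
apply/eqP; rewrite -subr_eq0 -mul_scalar_mx -mulmxBl.
by rewrite -[A - _]trmxK -trmx_mul uA trmx0.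
Qed.

Definition rot90 w : 'cV[R]_2 := \col_i if i == 0 then - w 1 0 else w 0 0.

(** The orthogonal complement of a line invariant under [A^T] is invariant under
    [A], and the two eigenvalues multiply to the determinant. *)
Lemma tr_rot90_eigen A w (a : R) : w != 0 -> a != 0 -> A^T *m w = a *: w ->
  A *m rot90 w = (\det A / a) *: rot90 w.
Proof.
move=> w0 a0 /matrixP E; have E0 := E 0 0; have E1 := E 1 0.
rewrite !mxE !sum_ord2 !mxE in E0 E1.
apply/matrixP => i j; rewrite (ord1 j) det2.
move: i; apply: ord2P; rewrite !mxE !sum_ord2 !mxE /=; apply: (mulfI a0).
  have -> : a * ((A 0 0 * A 1 1 - A 0 1 * A 1 0) / a * - w 1 0) =
     (A 0 0 * A 1 1 - A 0 1 * A 1 0) * - w 1 0 by field.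
  have -> : a * (A 0 0 * - w 1 0 + A 0 1 * w 0 0) =
     - A 0 0 * (a * w 1 0) + A 0 1 * (a * w 0 0) by ring.
  by rewrite -E0 -E1; ring.
have -> : a * ((A 0 0 * A 1 1 - A 0 1 * A 1 0) / a * w 0 0) =
   (A 0 0 * A 1 1 - A 0 1 * A 1 0) * w 0 0 by field.
have -> : a * (A 1 0 * - w 1 0 + A 1 1 * w 0 0) =
   - A 1 0 * (a * w 1 0) + A 1 1 * (a * w 0 0) by ring.
by rewrite -E0 -E1; ring.
Qed.

(** The component of [A^T *m rot90 w] along [rot90 w] is the eigenvalue [b], by
    adjunction; only the component [c] along [w] is left free. *)
Lemma tr_mul_rot90 A w (b : R) : w 0 0 ^+ 2 + w 1 0 ^+ 2 != 0 ->
  A *m rot90 w = b *: rot90 w ->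
  exists c, A^T *m rot90 w = b *: rot90 w + c *: w.
Proof.
move=> d0 /matrixP E; have E0 := E 0 0; have E1 := E 1 0.
rewrite !mxE !sum_ord2 !mxE /= in E0 E1.
pose z := A^T *m rot90 w.
exists ((z 0 0 * w 0 0 + z 1 0 * w 1 0) / (w 0 0 ^+ 2 + w 1 0 ^+ 2)).
have zb : z 0 0 * - w 1 0 + z 1 0 * w 0 0 = b * (w 0 0 ^+ 2 + w 1 0 ^+ 2).
  rewrite !mxE !sum_ord2 !mxE /=.
  have -> : b * (w 0 0 ^+ 2 + w 1 0 ^+ 2) =
    (b * - w 1 0) * - w 1 0 + (b * w 0 0) * w 0 0 by ring.
  by rewrite -E0 -E1; ring.
have bE : b = (z 0 0 * - w 1 0 + z 1 0 * w 0 0) / (w 0 0 ^+ 2 + w 1 0 ^+ 2).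
  by rewrite zb mulfK.
rewrite -/z; apply/matrixP => i j; rewrite (ord1 j) bE; clear -d0.
by move: i; apply: ord2P; rewrite !(mxE, eqxx) /=; field.
Qed.

End contraction_eigenvalues.

(** * Products leaving a line invariant *)

Lemma sum_geometric_le (R : realType) (p : R) (N : nat) : 0 <= p -> p < 1 ->
  \sum_(1 <= n < N) p ^+ n <= (1 - p)^-1.
Proof.
move=> p0 p1; rewrite -[leRHS]mul1r ler_pdivlMr ?subr_gt0 //.
suff h : (\sum_(1 <= n < N) p ^+ n) * (1 - p) <= 1 - p ^+ N.
  by apply: le_trans h _; rewrite gerBl exprn_ge0.
elim: N => [|[|N] IH].
- by rewrite big_geq // mul0r expr0 subrr.
- by rewrite big_geq // mul0r expr1 subr_ge0 ltW.
- by rewrite big_nat_recr //= mulrDl [p ^+ N.+2]exprSr; move: IH; lra.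
Qed.

Section triangular.
Variables (R : realType) (m : nat) (T : 'I_m -> 'M[R]_2).
Variable x : R.
Hypotheses (x0 : 0 <= x) (x1 : x < 1).

Lemma orbit_sumZ (k : R) u n :
  orbit_sum T x (k *: u) n = `|k| `^ x * orbit_sum T x u n.
Proof.
rewrite /orbit_sum mulr_sumr; apply: eq_bigr => I _.
by rewrite -scalemxAr normrZ powRM.
Qed.

Lemma orbit_sumD u v n :
  orbit_sum T x (u + v) n <= orbit_sum T x u n + orbit_sum T x v n.
Proof.
rewrite /orbit_sum -big_split; apply: ler_sum => I _ /=.
apply: le_trans (powRD_le _ _ x0 (ltW x1)) => //.
by rewrite ge0_ler_powR ?nnegrE ?addr_ge0 // mulmxDr ler_normD.
Qed.

Lemma orbit_sum_eigen (a : 'I_m -> R) w n :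
  (forall i, (T i)^T *m w = a i *: w) ->
  orbit_sum T x w n = `|w| `^ x * power_sum (fun i => `|a i|) x ^+ n.
Proof.
move=> Tw; elim: n => [|n IH].
  rewrite /orbit_sum /word_prod.
  rewrite (sum_words0 (fun s => `|(\prod_(i <- s) T i)^T *m w| `^ x)).
  by rewrite big_nil trmx1 mul1mx mulr1.
rewrite orbit_sumS exprSr mulrA mulr_sumr; apply: eq_bigr => i _.
by rewrite Tw orbit_sumZ IH mulrC.
Qed.

(** With respect to [w] and [v] the transposed matrices are triangular, and
    prefixing a letter gives [S n.+1 <= q * S n + L] for the orbit sums [S n] of
    [v], where [q < 1] is the power sum of the [b i] and [L] bounds the
    contribution of the off-diagonal entries. *)
Lemma orbit_sum_triangular (a b c : 'I_m -> R) v w :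
  (forall i, (T i)^T *m w = a i *: w) ->
  (forall i, (T i)^T *m v = b i *: v + c i *: w) ->
  power_sum (fun i => `|a i|) x < 1 -> power_sum (fun i => `|b i|) x < 1 ->
  exists M, forall n, orbit_sum T x v n <= M.
Proof.
move=> Tw Tv; set p := power_sum _ _; set q := power_sum _ _ => p1 q1.
have p0 : 0 <= p by exact: power_sum_ge0.
pose L := \sum_i `|c i| `^ x * `|w| `^ x.
have L0 : 0 <= L by apply: sumr_ge0 => i _; rewrite mulr_ge0 ?powR_ge0.
have step n : orbit_sum T x v n.+1 <= q * orbit_sum T x v n + L.
  rewrite orbit_sumS /q /power_sum mulr_suml /L -big_split.
  apply: ler_sum => i _ /=; rewrite Tv; apply: le_trans (orbit_sumD _ _ _) _.
  rewrite !orbit_sumZ lerD2l ler_wpM2l ?powR_ge0 //.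
  by rewrite (orbit_sum_eigen _ Tw) ler_piMr ?powR_ge0 // exprn_ile1 // ltW.
have q0 : 0 <= q by exact: power_sum_ge0.
(* L / (1 - q) is the fixed point of z |-> q * z + L. *)
pose M := orbit_sum T x v 0 + L / (1 - q).
have M0 : q * M + L <= M.
  have ME : M = q * M + L + (1 - q) * orbit_sum T x v 0.
    by rewrite /M; field; lra.
  by rewrite [leRHS]ME lerDl mulr_ge0 ?orbit_sum_ge0 // subr_ge0 ltW.
exists M; elim=> [|n IH]; first by rewrite /M lerDl divr_ge0 // subr_ge0 ltW.
apply: le_trans (step n) _; apply: le_trans M0.
by rewrite lerD2r ler_wpM2l.
Qed.

(** The norm of a product is at least its eigenvalue on the common eigenvector,
    up to the factor 2 of the sup norm; the other factor 2 compares the sup norm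
    with the singular value. *)
Lemma svf_sum_ge_eigen (b : 'I_m -> R) (v : 'cV[R]_2) n : v != 0 ->
  (forall i, T i *m v = b i *: v) ->
  4^-1 * power_sum (fun i => `|b i|) x ^+ n <= svf_sum T x n.
Proof.
move=> v0 Tv; rewrite mulrC ler_pdivrMr // mulrC /power_sum -sum_words_prod.
rewrite /svf_sum mulr_sumr; apply: ler_sum => I _.
rewrite -powR_prod // -normr_prod.
have TI : word_prod T I *m v = (\prod_(i <- I) b i) *: v.
  rewrite /word_prod; elim: (tval I) => [|i s IH].
    by rewrite !big_nil mul1mx scale1r.
  by rewrite !big_cons -mulmxE -mulmxA IH -scalemxAr Tv scalerA mulrC.
have bI : `|\prod_(i <- I) b i| <= 2 * `|word_prod T I|.
  rewrite -(@ler_pM2r _ `|v|) ?normr_gt0 // -normrZ -TI -mulrA.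
  exact: mx_norm_mul.
apply: (@le_trans _ _ ((2 * `|word_prod T I|) `^ x)).
  by rewrite ge0_ler_powR ?nnegrE ?mulr_ge0.
rewrite powRM //; apply: (@le_trans _ _ (2 * (2 * svf x (word_prod T I)))).
  by rewrite ler_pM ?powR_ge0 ?le_svf // powR_le2 // ltW.
by rewrite mulrA -natrM.
Qed.

End triangular.

Section invariant_line.
Variables (R : realType) (m : nat) (T : 'I_m -> 'M[R]_2).
Hypotheses (Tinv : forall i, T i \in unitmx).
Hypotheses (Tcontr : forall i, opnorm (T i) < 1).
Variables (w : 'cV[R]_2) (a : 'I_m -> R).
Hypotheses (w0 : w != 0) (Tw : forall i, (T i)^T *m w = a i *: w).
Let b i := \det (T i) / a i.

Lemma rot90_neq0 : rot90 w != 0.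
Proof.
apply: contra w0 => /eqP/matrixP E; have := E 0 0; have := E 1 0.
rewrite !mxE /= => w00 /eqP; rewrite oppr_eq0 => /eqP w10.
by apply/eqP/matrixP => i j; rewrite (ord1 j) mxE; move: i; apply: ord2P.
Qed.

Lemma eigen_neq0 i : a i != 0.
Proof.
apply: contra w0 => /eqP a0.
have Tu : (T i)^T \in unitmx by rewrite unitmx_tr.
by rewrite -(mulKmx Tu w) Tw a0 scale0r mulmx0.
Qed.

Lemma rot90_eigen i : T i *m rot90 w = b i *: rot90 w.
Proof. by apply: tr_rot90_eigen => //; exact: eigen_neq0. Qed.

Lemma eigen_lt1 i : 0 < `|a i| < 1.
Proof.
rewrite normr_gt0 eigen_neq0 /=.
exact: le_lt_trans (tr_eigenvalue_le_opnorm w0 (Tw i)) (Tcontr i).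
Qed.

Lemma coeigen_lt1 i : 0 < `|b i| < 1.
Proof.
rewrite normr_gt0 mulf_neq0 ?invr_neq0 ?eigen_neq0 -?unitfE -?unitmxE //=.
exact: le_lt_trans (eigenvalue_le_opnorm rot90_neq0 (rot90_eigen i)) (Tcontr i).
Qed.

(** The vectors [w] and [rot90 w] form a basis, and the orbit sums of both are
    bounded: those of [w] are geometric, those of [rot90 w] contract. *)
Lemma svf_sum_bounded x : 0 <= x -> x < 1 ->
  power_sum (fun i => `|a i|) x < 1 -> power_sum (fun i => `|b i|) x < 1 ->
  exists M, forall n, svf_sum T x n <= M.
Proof.
move=> x0 x1 p1 q1.
have d0 := dot_gt0 w0.
have Tv i : exists c, (T i)^T *m rot90 w = b i *: rot90 w + c *: w.
  by apply: tr_mul_rot90 (rot90_eigen i); rewrite gt_eqF.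
have [c Tc] := choice Tv.
have [M hM] := orbit_sum_triangular x0 x1 Tw Tc p1 q1.
have ind : w 0 0 * rot90 w 1 0 - w 1 0 * rot90 w 0 0 != 0.
  by rewrite !mxE /= mulrN opprK -!expr2 gt_eqF.
have [C C0 hC] := svf_sum_le_orbits T x0 x1 ind.
exists (C * (`|w| `^ x + M)) => n; apply: le_trans (hC n) _.
rewrite ler_wpM2l // lerD // (orbit_sum_eigen _ _ Tw) ler_piMr ?powR_ge0 //.
by rewrite exprn_ile1 ?power_sum_ge0 // ltW.
Qed.

End invariant_line.

(** * Convergence below the affinity dimension *)

Lemma det_neq0_notin_line (R : realType) (w v : 'cV[R]_2) :
  w != 0 -> v \notin <[w]>%VS -> w 0 0 * v 1 0 - w 1 0 * v 0 0 != 0.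
Proof.
move=> w0; apply: contra; rewrite subr_eq0 => /eqP E.
have [w00|w00] := eqVneq (w 0 0) 0.
  have w10 : w 1 0 != 0.
    apply: contra w0 => /eqP w10; apply/eqP/matrixP => i j.
    by rewrite (ord1 j) mxE; move: i; apply: ord2P.
  apply/vlineP; exists (v 1 0 / w 1 0); apply/matrixP => i j.
  rewrite (ord1 j) mxE; move: i; apply: ord2P; last by rewrite divfK.
  rewrite w00 mulr0; move: E; rewrite w00 mul0r => /esym/eqP.
  by rewrite mulf_eq0 (negbTE w10) => /eqP.
apply/vlineP; exists (v 0 0 / w 0 0); apply/matrixP => i j.
rewrite (ord1 j) mxE; move: i; apply: ord2P; first by rewrite divfK.
by apply: (mulfI w00); rewrite E [RHS]mulrA [w 0 0 * _]mulrC divfK // mulrC.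
Qed.

Section summable_below_dim.
Variables (R : realType) (m : nat) (T : 'I_m -> 'M[R]_2).
Hypotheses (m0 : (0 < m)%N) (Tinv : forall i, T i \in unitmx).
Variables (W : {vspace 'cV[R]_2}) (hW : \dim W = 1%N).
Variable x : R.
Hypotheses (x0 : 0 <= x) (x1 : x < 1) (xdim : (x%:E < dim_aff T)%E).
Hypothesis (sumW : summable_orbit T W x).
Let w := vpick W.

Lemma svf_sum_unbounded M : ~ forall n, svf_sum T x n <= M.
Proof. by move=> /(dim_aff_le m0 Tinv x0 x1); rewrite leNgt xdim. Qed.

(** If [T_i^T w] is not on the line, it forms a basis with [w]; its orbit sums
    are part of those of [w], since it is the image of [w] under a letter. *)
Lemma summable_invariant i : (T i)^T *m w \in <[w]>%VS.
Proof.
have [M hM] := sumW; have w0 : w != 0 by exact: vpick_line_neq0.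
have orbit_le n : orbit_sum T x w n.+1 <= M.
  apply: le_trans (hM n.+2); rewrite big_nat_recr //= lerDr.
  by apply: sumr_ge0 => k _; exact: orbit_sum_ge0.
apply: contrapT => /negP /(det_neq0_notin_line w0) ind.
have [C C0 hC] := svf_sum_le_orbits T x0 x1 ind.
apply: (@svf_sum_unbounded (C * ((orbit_sum T x w 0 + M) + M))) => n.
apply: le_trans (hC n) _; rewrite ler_wpM2l // lerD //.
  case: n => [|n].
    by rewrite lerDl (le_trans _ (orbit_le 0%N)) ?orbit_sum_ge0.
  by rewrite (le_trans (orbit_le n)) // lerDr orbit_sum_ge0.
apply: le_trans (orbit_le n); rewrite orbit_sumS (bigD1 i) //= lerDl.
by apply: sumr_ge0 => *; exact: orbit_sum_ge0.
Qed.

Lemma summable_power_sum_lt1 (a : 'I_m -> R) :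
  (forall i, (T i)^T *m w = a i *: w) -> power_sum (fun i => `|a i|) x < 1.
Proof.
move=> Tw; have [M hM] := sumW; rewrite ltNge; apply/negP => p1.
have k0 : 0 < `|w| `^ x by rewrite powR_gt0 // normr_gt0 vpick_line_neq0.
have [N hN] : exists N : nat, M / (`|w| `^ x) < N%:R.
  exists (Num.bound `|M / (`|w| `^ x)|).
  exact: le_lt_trans (ler_norm _) (archi_boundP (normr_ge0 _)).
move: hN; rewrite ltr_pdivrMr // ltNge => /negP; apply.
apply: le_trans (hM N.+1).
have -> : N%:R * `|w| `^ x = \sum_(1 <= n < N.+1) `|w| `^ x.
  by rewrite sumr_const_nat subn1 mulr_natl.
apply: ler_sum => n _.
by rewrite (orbit_sum_eigen _ _ Tw) ler_peMr ?(ltW k0) // exprn_ege1.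
Qed.

(** A single matrix has affinity dimension 0, the sums at exponent 0 being the
    numbers of words. *)
Lemma card_letters_gt1 : (1 < m)%N.
Proof.
rewrite ltnNge; apply/negP => m1.
have dim0 : (dim_aff T <= 0%:E)%E.
  apply: (@dim_aff_le _ _ _ _ m0 Tinv (lexx 0) ltr01 1) => n.
  rewrite /svf_sum; under eq_bigr do rewrite svf_lt1 ?lexx ?ltr01 // powRr0.
  rewrite sumr_const card_tuple card_ord.
  have -> : m = 1%N by apply/eqP; rewrite eqn_leq m1.
  by rewrite exp1n.
by have := lt_le_trans xdim dim0; rewrite lte_fin ltNge x0.
Qed.

End summable_below_dim.

(** * The characterization *)

Theorem proposition7p1 (R : realType) (m : nat) (hm : (0 < m)%N)
    (T : 'I_m -> 'M[R]_2)
    (Tinv : forall i, T i \in unitmx)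
    (Tcontr : forall i, opnorm (T i) < 1)
    (W : {vspace 'cV[R]_2}) (hW : \dim W = 1%N) :
  (dim_aff_proj T W < mine 1 (dim_aff T))%E
  <->
  (forall i, (linfun (mulmx (T i)^T) @: W)%VS = W) /\
  (exists a : 'I_m -> R,
     (forall i w, w \in W -> (T i)^T *m w = a i *: w) /\
     let b := fun i => \det (T i) / a i in
     exists s t : R,
       [/\ unique (fun x => 0 < x /\ \sum_(i < m) `|a i| `^ x = 1) t,
           unique (fun x => 0 < x /\ \sum_(i < m) `|b i| `^ x = 1) s
         & t < Num.min 1 s]).
Proof.
pose w := vpick W; have w0 : w != 0 by exact: vpick_line_neq0.
have WE : W = <[w]>%VS by exact: line_vpick.
split=> [/ereal_inf_ltP[_ [x [x0 sum_fin] <-]]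
  | [_ [a [Wa [s [t [tP sP tlt]]]]]]].
  rewrite lt_min lte_fin => /andP[x1 xdim].
  have sumW := (summable_orbitP T hW x0 x1).1 sum_fin.
  have TW := summable_invariant hm Tinv hW x0 x1 xdim sumW.
  have /choice[a Tw] i : exists k, (T i)^T *m w = k *: w.
    by apply/vlineP; exact: TW.
  have a01 := eigen_lt1 Tinv Tcontr w0 Tw.
  have b01 := coeigen_lt1 Tinv Tcontr w0 Tw.
  have p1 := summable_power_sum_lt1 hW sumW Tw.
  have m1 := card_letters_gt1 hm Tinv x0 xdim.
  have [t [[t0 pt] tu]] := power_sum_root a01 m1.
  have [s [[s0 qs] su]] := power_sum_root b01 m1.
  split.
    move=> i; rewrite WE limg_line lfunE /= Tw.
    apply/eqP; rewrite eqEdim !dim_vline w0 scaler_eq0 (negbTE w0).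
    have -> : (a i == 0) = false by apply/negbTE/(eigen_neq0 Tinv w0 Tw).
    by rewrite leqnn andbT -memvE memvZ // memv_line.
  exists a; split.
    move=> i u; rewrite WE => /vlineP[k ->].
    by rewrite -scalemxAr Tw !scalerA mulrC.
  exists s, t; split => //.
  have tx : t < x.
    rewrite ltNge le_eqVlt; apply/negP => /predU1P[xt|].
      by move: p1; rewrite xt pt ltxx.
    by move/(power_sum_decr a01 hm)/lt_trans/(_ p1); rewrite pt ltxx.
  rewrite lt_min (lt_trans tx x1) /= ltNge; apply/negP => st.
  have q1 : power_sum (fun i => `|\det (T i) / a i|) x < 1.
    by rewrite -qs; apply: (power_sum_decr b01 hm); exact: le_lt_trans tx.
  have [C hC] := svf_sum_bounded Tinv w0 Tw x0 x1 p1 q1.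
  exact: (svf_sum_unbounded hm Tinv x0 x1 xdim (M := C)).
have Tw i : (T i)^T *m w = a i *: w by apply: Wa; exact: memv_pick.
have a01 := eigen_lt1 Tinv Tcontr w0 Tw.
have b01 := coeigen_lt1 Tinv Tcontr w0 Tw.
have [[t0 pt] _] := tP; have [[s0 qs] _] := sP.
set y := Num.min 1 s in tlt.
have y1 : y <= 1 by rewrite ge_min lexx.
have ys : y <= s by rewrite ge_min lexx orbT.
pose x := (t + y) / 2.
have x0 : 0 <= x by rewrite /x; lra.
have xy : x < y by rewrite /x; lra.
have tx : t < x by rewrite /x; lra.
have x1 : x < 1 by exact: lt_le_trans y1.
apply: (@le_lt_trans _ _ x%:E).
  apply: ereal_inf_lbound; exists x => //; split=> //.
  apply: (summable_orbitP T hW x0 x1).2.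
  have p1 : power_sum (fun i => `|a i|) x < 1.
    by rewrite -pt; exact: power_sum_decr.
  exists (`|w| `^ x * (1 - power_sum (fun i => `|a i|) x)^-1) => N.
  under eq_bigr do rewrite (orbit_sum_eigen _ _ Tw).
  by rewrite -mulr_sumr ler_wpM2l ?powR_ge0 // sum_geometric_le ?power_sum_ge0.
rewrite (@lt_le_trans _ _ y%:E) ?lte_fin // le_min lee_fin y1 /=.
apply: dim_aff_ge => // z z0 zy.
exists 4^-1, (power_sum (fun i => `|\det (T i) / a i|) z); split => //.
  by rewrite -qs; apply: power_sum_decr => //; exact: lt_le_trans ys.
move=> n; apply: (svf_sum_ge_eigen z0 (lt_le_trans zy y1) _ (rot90_neq0 w0)).
by move=> i; exact: (rot90_eigen Tinv w0 Tw i).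
Qed.
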